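(* For $n\ge 1$, the perfect matching complex $\mathcal{M}_p(\mathcal{G}_{2\times n})$ of the $(2\times n)$-grid graph is contractible if $n$ is odd, and is homotopy equivalent to the sphere $\mathbb{S}^k$ if $n$ is even and $n=2k+2$. *)

(* Defs.v *)
From HB Require Import structures.
From mathcomp Require Import all_boot all_order all_algebra.
From mathcomp Require Import all_classical all_reals all_analysis.

Set Implicit Arguments.
Unset Strict Implicit.
Unset Printing Implicit Defensive.

Import Order.TTheory GRing.Theory Num.Theory.
Import numFieldNormedType.Exports.
Local Open Scope classical_set_scope.
Local Open Scope ring_scope.

(** * Topology: homotopy, homotopy equivalence, contractibility, spheres.
    Spaces are subsets of ambient topological types, with the subspace
    topology (expressed via [{within A, continuous f}]). *)

Definition unit_interval (R : realType) : set R := [set t | 0 <= t <= 1].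
Arguments unit_interval R : clear implicits.

Definition homotopy_in (R : realType) (T : topologicalType) (X : set T)
    (f g : T -> T) (H : R * T -> T) : Prop :=
  [/\ ({within unit_interval R `*` X, continuous H}),
      (forall t x, unit_interval R t -> X x -> X (H (t, x))),
      (forall x, X x -> H (0, x) = f x) &
      (forall x, X x -> H (1, x) = g x)].

Definition homotopic_in (R : realType) (T : topologicalType) (X : set T)
    (f g : T -> T) : Prop :=
  exists H : R * T -> T, homotopy_in X f g H.

Definition homotopy_equivalent (R : realType) (T1 T2 : topologicalType)
    (X : set T1) (Y : set T2) : Prop :=
  exists (f : T1 -> T2) (g : T2 -> T1),
    [/\ {within X, continuous f} /\ {within Y, continuous g},
        (forall x, X x -> Y (f x)), (forall y, Y y -> X (g y)),
        homotopic_in R X (g \o f) id &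
        homotopic_in R Y (f \o g) id].

Definition contractible (R : realType) (T : topologicalType) (X : set T) : Prop :=
  exists2 x0, X x0 & homotopic_in R X (fun _ => x0) id.

Definition sphere (R : realType) (k : nat) : set 'rV[R]_(k.+1) :=
  [set x | \sum_(i < k.+1) (x ord0 i) ^+ 2 = 1].
Arguments sphere R k : clear implicits.

Definition grid_vertex (n : nat) := ('I_2 * 'I_n)%type.

Definition grid_adj (n : nat) (u v : grid_vertex n) : bool :=
  ((u.1 == v.1) && ((u.2.+1 == v.2 :> nat) || (v.2.+1 == u.2 :> nat)))
  || ((u.2 == v.2) && ((u.1.+1 == v.1 :> nat) || (v.1.+1 == u.1 :> nat))).

Definition is_grid_edge (n : nat) (e : {set grid_vertex n}) : bool :=
  [exists u, exists v, grid_adj u v && (e == [set u; v]%SET)].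

Definition grid_edge (n : nat) := {e : {set grid_vertex n} | is_grid_edge e}.

Definition perfect_matching (n : nat) (M : {set grid_edge n}) : bool :=
  [forall v : grid_vertex n, #|[set e in M | v \in val e]%SET| == 1%N].

Definition pm_face (n : nat) (s : {set grid_edge n}) : Prop :=
  exists M : {set grid_edge n}, perfect_matching M /\ s \subset M.

Definition pm_complex_realization (R : realType) (n : nat)
    : set {ptws grid_edge n -> R} :=
  [set x | (forall e, 0 <= x e) /\ (\sum_e x e = 1) /\
           pm_face [set e | x e != 0]%SET].
Arguments pm_complex_realization R n : clear implicits.

(* Main.v *)
Require Import Defs.
From HB Require Import structures.
From mathcomp Require Import all_boot all_order all_algebra.
From mathcomp Require Import all_classical all_reals all_analysis.
From mathcomp Require Import zify ring.
Import numFieldNormedType.Exports.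

Set Implicit Arguments.
Unset Strict Implicit.
Unset Printing Implicit Defensive.

Import Order.TTheory GRing.Theory Num.Theory.
Local Open Scope ring_scope.
Local Open Scope classical_set_scope.

(* In a perfect matching of the 2 x n grid the horizontal edges occur in pairs
   h_c, h'_c, one above the other; together with the vertical edges v_c they
   tile the grid.  Group the columns into blocks {2j, 2j+1}.  In block j, move
   the mass of v_(2j+1), h_(2j+1), h'_(2j+1) linearly onto v_(2j), and that of
   h'_(2j) onto h_(2j).  The only edges excluding v_(2j) are h_(2j), which
   already excludes what is moved onto v_(2j), and h_(2j-1), whose mass is gone
   once block j-1 has been treated.  So treating the blocks from left to right
   retracts the complex onto the one spanned by the v_(2j) and h_(2j), in which
   the only exclusions are between v_(2j) and h_(2j).  For n = 2k+2 this is the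
   boundary of the (k+1)-dimensional cross-polytope, a k-sphere; for n odd the
   last block only contains v_(n-1), so the complex is a cone. *)

(** * Dominoes and the faces of the perfect matching complex *)

(* [(None, c)] is the vertical domino in column [c], and [(Some r, c)] the
   horizontal one in row [r] covering the columns [c] and [c.+1]. *)
Definition domino_code := (option 'I_2 * nat)%type.

Definition valid (n : nat) (k : domino_code) : bool :=
  if k.1 is Some _ then (k.2.+1 < n)%N else (k.2 < n)%N.

Definition covers (n : nat) (k : domino_code) (u : grid_vertex n) : bool :=
  if k.1 is Some r then (u.1 == r) && ((u.2 == k.2 :> nat) || (u.2 == k.2.+1 :> nat))
  else u.2 == k.2 :> nat.

Definition domino (n : nat) (k : domino_code) : {set grid_vertex n} :=
  [set u | covers k u]%SET.

Lemma ord2_neq (a b r : 'I_2) : a != b -> (r == a) || (r == b).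
Proof. by case: a => [[|[|]] ?]; case: b => [[|[|]] ?]; case: r => [[|[|]] ?]. Qed.

Lemma domino_is_edge n k : valid n k -> is_grid_edge (domino n k).
Proof.
case: k => [[r|] c]; rewrite /valid /= => hc; apply/existsP; last first.
  exists (ord0, Ordinal hc); apply/existsP; exists (ord_max, Ordinal hc).
  rewrite /grid_adj /= !eqxx /=; apply/eqP/setP => -[a b].
  rewrite !inE /covers /= !xpair_eqE -(inj_eq val_inj b) /=.
  by case: eqP => _; rewrite ?andbF // !andbT; apply/esym/ord2_neq.
have hc' : (c < n)%N by lia.
exists (r, Ordinal hc'); apply/existsP; exists (r, Ordinal hc).
rewrite /grid_adj /= !eqxx /=; apply/eqP/setP => -[a b].
by rewrite !inE /covers /= !xpair_eqE -!(inj_eq val_inj b) /= -andb_orr.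
Qed.

Lemma edge_is_domino n (e : grid_edge n) :
  exists k, valid n k /\ val e = domino n k.
Proof.
case: e => e /= /existsP[[a b] /existsP[[a' b'] /andP[adj /eqP ->]]].
have hb := ltn_ord b; have hb' := ltn_ord b'.
move: adj; rewrite /grid_adj /=.
case/orP=> /andP[/eqP eqab /orP[/eqP|/eqP]] h.
- exists (Some a, val b); split=> /=; first by rewrite /valid /= h.
  apply/setP => -[x y]; rewrite !inE /covers /= !xpair_eqE -!(inj_eq val_inj y) /=.
  by rewrite -eqab h -andb_orr.
- exists (Some a, val b'); split=> /=; first by rewrite /valid /= h.
  apply/setP => -[x y]; rewrite !inE /covers /= !xpair_eqE -!(inj_eq val_inj y) /=.
  by rewrite -eqab h -andb_orr orbC.
all: have neq : a != a' by apply/eqP => eqa; rewrite eqa in h; lia.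
all: exists (None, val b); split=> //=; apply/setP => -[x y].
all: rewrite !inE /covers /= !xpair_eqE -eqab -!(inj_eq val_inj y) /=.
all: by rewrite -andb_orl ord2_neq.
Qed.

Lemma domino_inj n k k' :
  valid n k -> valid n k' -> domino n k = domino n k' -> k = k'.
Proof.
move=> vk vk' /setP eqk.
have {}eqk (u : grid_vertex n) : covers k u = covers k' u by move: (eqk u); rewrite !inE.
case: k k' vk vk' eqk => [[r|] c] [[r'|] c'] /= hc hc' eqk.
- rewrite /valid /= in hc hc'.
  have lc : (c < n)%N by lia.
  have lc' : (c' < n)%N by lia.
  have := eqk (r, Ordinal lc); have := eqk (r', Ordinal lc').
  rewrite /covers /= !eqxx /= => /andP[/eqP-> h1] /esym/andP[_ h2].
  by congr pair; lia.
(* In column [c'], the cell in the row other than [r] is covered by the vertical domino but not by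
   the horizontal one. *)
- have := eqk (if r == ord0 then ord_max else ord0, Ordinal hc').
  by rewrite /covers /= eqxx; case: r {eqk hc} => -[|[|]].
- have := eqk (if r' == ord0 then ord_max else ord0, Ordinal hc).
  by rewrite /covers /= eqxx; case: r' {eqk hc'} => -[|[|]].
- have := eqk (ord0, Ordinal hc).
  by rewrite /covers /= eqxx => /esym/eqP ->.
Qed.

Definition edge_code n (e : grid_edge n) : domino_code := projT1 (cid (edge_is_domino e)).

Lemma code_valid n (e : grid_edge n) : valid n (edge_code e).
Proof. by rewrite /edge_code; case: cid => k []. Qed.

Lemma codeK n (e : grid_edge n) : val e = domino n (edge_code e).
Proof. by rewrite /edge_code; case: cid => k []. Qed.

Lemma mem_code n (e : grid_edge n) u : (u \in val e) = covers (edge_code e) u.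
Proof. by rewrite codeK inE. Qed.

Lemma code_inj n : injective (@edge_code n).
Proof. by move=> e e' h; apply: val_inj; rewrite !codeK h. Qed.

Lemma codeE n (e : grid_edge n) k : valid n k -> val e = domino n k -> edge_code e = k.
Proof. by move=> vk; rewrite codeK; apply: domino_inj => //; exact: code_valid. Qed.

Lemma code_surj n k : valid n k -> exists e : grid_edge n, edge_code e = k.
Proof.
move=> vk; exists (Sub (domino n k) (domino_is_edge vk)).
by apply: codeE => //; rewrite SubK.
Qed.

(* A perfect matching of the grid is encoded by the set [d] of the columns at
   which a pair of horizontal dominoes starts. *)
Definition admissible (n : nat) (d : pred nat) : Prop :=
  forall i, d i -> (i.+1 < n)%N /\ ~~ d i.+1.

Definition tile (d : pred nat) (k : domino_code) : bool :=
  if k.1 is Some _ then d k.2 else ~~ d k.2 && ((k.2 == 0) || ~~ d k.2.-1)%N.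

(** A cell of column [b] meets a horizontal domino starting at [b], one starting at [b.-1], or the
    vertical one. Admissibility makes these cases exclusive and keeps the dominoes inside the
    grid. *)
Lemma perfect_matching_tile n d : admissible n d ->
  perfect_matching [set e : grid_edge n | tile d (edge_code e)]%SET.
Proof.
move=> ad; apply/forallP => -[a b].
(* The one domino of the tiling that covers the cell [(a, b)]. *)
pose k : domino_code := if d b then (Some a, val b)
  else if (0 < b)%N && d b.-1 then (Some a, b.-1) else (None, val b).
have hb := ltn_ord b.
have vk : valid n k.
  rewrite /k; case: ifP => [/ad[]//|_]; case: ifP => [/andP[_ /ad[]]//|_ //].
have [e ek] := code_surj vk.
apply/cards1P; exists e; apply/setP => e'; rewrite !inE mem_code.
apply/idP/eqP => [|->]; last first.
  rewrite ek /k /tile /covers.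
  case: ifP => [db|ndb]; first by rewrite /= db !eqxx.
  case: ifP => [/andP[b0 db]|ndb']; first by rewrite /= db prednK // !eqxx orbT.
  by rewrite /= ndb eqxx /=; case: (b : nat) ndb' => //= b' ->.
move=> /andP[tk ck]; apply: code_inj; rewrite ek.
move: tk ck; case: (edge_code e') => -[r|] c; rewrite /tile /covers /k /=.
  move=> dc /andP[/eqP<- /orP[/eqP->|/eqP->]]; first by rewrite dc.
  by have [_ /negbTE->] := ad _ dc; rewrite /= dc.
by move=> /andP[ndc h] /eqP->; rewrite (negbTE ndc); case: (c) h => //= c' /negbTE->.
Qed.

(** * Perfect matchings come from admissible column sets *)

Section MatchingIsTiling.
Variables (n : nat) (M : {set grid_edge n}).
Hypothesis pmM : perfect_matching M.

Let matched (k : domino_code) : bool := [exists e, (e \in M) && (edge_code e == k)].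

Let matched_uniq k k' (u : grid_vertex n) :
  matched k -> matched k' -> covers k u -> covers k' u ->
  k = k' :> domino_code.
Proof.
move=> /existsP[e /andP[eM /eqP<-]] /existsP[e' /andP[e'M /eqP<-]].
rewrite -!mem_code => ue ue'; move/forallP/(_ u)/cards1P : pmM => [x /setP xE].
have := xE e; have := xE e'; rewrite !inE eM e'M ue ue' => /esym/eqP -> /esym/eqP ->.
by [].
Qed.

Let matched_cover (u : grid_vertex n) : exists2 k, matched k & covers k u.
Proof.
move/forallP/(_ u)/cards1P : pmM => [x /setP/(_ x)]; rewrite !inE eqxx.
move=> /andP[xM]; rewrite mem_code => cx; exists (edge_code x) => //.
by apply/existsP; exists x; rewrite xM eqxx.
Qed.

Let matched_valid k : matched k -> valid n k.
Proof. by move=> /existsP[e /andP[_ /eqP<-]]; exact: code_valid. Qed.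

(* If only one row had a horizontal domino at column [i], the other row would
   have one at column [i.-1], without partner; descend on [i]. *)
Let matched_pair i (a b : 'I_2) : matched (Some a, i) -> matched (Some b, i).
Proof.
case: (eqVneq a b) => [->//|]; elim: i a b => [|i ih] a b neq ma.
all: have := matched_valid ma; rewrite /valid /= => va.
all: apply: contraT => nmb.
- have l0 : (0 < n)%N by lia.
  have [[[r|] c] mk] := matched_cover (b, Ordinal l0); rewrite /covers /=.
    by move=> /andP[/eqP er /orP[/eqP ec|//]]; move: mk; rewrite -er -ec (negbTE nmb).
  move=> /eqP ec; suff: (Some a, 0%N) = (None, c) :> domino_code by [].
  by apply: (@matched_uniq _ _ (a, Ordinal l0)) => //; rewrite /covers /= -?ec ?eqxx.
- have l0 : (i.+1 < n)%N by lia.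
  have [[[r|] c] mk] := matched_cover (b, Ordinal l0); rewrite /covers /=.
    move=> /andP[/eqP er /orP[/eqP ec|/eqP[ec]]]; first by move: mk; rewrite -er -ec (negbTE nmb).
    rewrite -er -ec in mk.
    suff: (Some a, i) = (Some a, i.+1) :> domino_code by case; lia.
    apply: (@matched_uniq _ _ (a, Ordinal l0)) => //; rewrite /covers /= ?eqxx ?orbT //.
    by apply: ih mk; rewrite eq_sym.
  move=> /eqP ec; suff: (Some a, i.+1) = (None, c) :> domino_code by [].
  by apply: (@matched_uniq _ _ (a, Ordinal l0)) => //; rewrite /covers /= -?ec ?eqxx.
Qed.

(** The column set is read off the row [ord0]; by [matched_pair] the other row gives the same one.
    An inclusion is enough, since faces are closed under subsets. *)
Lemma perfect_matching_sub_tiling :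
  exists2 d, admissible n d & {in M, forall e, tile d (edge_code e)}.
Proof.
exists (fun i => matched (Some ord0, i)).
  move=> i mi; have := matched_valid mi; rewrite /valid /= => vi; split=> //.
  apply/negP => mi'.
  suff: (Some ord0, i) = (Some ord0, i.+1) :> domino_code by case; lia.
  by apply: (@matched_uniq _ _ (ord0, Ordinal vi)) => //; rewrite /covers /= !eqxx ?orbT.
move=> e eM; have : matched (edge_code e) by apply/existsP; exists e; rewrite eM eqxx.
case: (edge_code e) => -[r|] c mk; rewrite /tile /=; first exact: matched_pair mk.
have := matched_valid mk; rewrite /valid /= => vc.
apply/andP; split.
  apply/negP => mh; suff: (Some ord0, c) = (None, c) :> domino_code by [].
  by apply: (@matched_uniq _ _ (ord0, Ordinal vc)) => //; rewrite /covers /= !eqxx.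
case: c mk vc => //= c mk vc.
apply/negP => mh; suff: (Some ord0, c) = (None, c.+1) :> domino_code by [].
by apply: (@matched_uniq _ _ (ord0, Ordinal vc)) => //; rewrite /covers /= !eqxx ?orbT.
Qed.

End MatchingIsTiling.

Lemma pm_faceP n (s : {set grid_edge n}) :
  pm_face s <-> exists2 d, admissible n d & {in s, forall e, tile d (edge_code e)}.
Proof.
split=> [[M [pmM /fintype.subsetP sM]]|[d ad ds]].
  have [d ad dM] := perfect_matching_sub_tiling pmM.
  by exists d => // e /sM; exact: dM.
exists [set e | tile d (edge_code e)]%SET; split; first exact: perfect_matching_tile.
by apply/fintype.subsetP => e /ds; rewrite inE.
Qed.

(** * Standard dominoes and the collapse of column sets *)

Definition block (k : domino_code) : nat := k.2./2.

Definition positive (k : domino_code) : bool := (k.1 == None) || odd k.2.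

(** These are the vertices of the cross-polytope: [b = true] gives the positive unit vector of axis
    [j], [b = false] its opposite. *)
Definition standard (b : bool) (j : nat) : domino_code :=
  (if b then None else Some ord0, j.*2).

Definition retract (k : domino_code) : domino_code := standard (positive k) (block k).

Lemma standard_inj b b' j j' : standard b j = standard b' j' -> b = b' /\ j = j'.
Proof. by rewrite /standard => /pair_equal_spec[]; case: b b' => -[] // _ eqj;
  split=> //; lia. Qed.

(** A horizontal retract arises only from a horizontal domino over the same two columns, so for [n]
    odd no horizontal edge is ever requested in the last block. *)
Lemma retract_valid n k : valid n k -> valid n (retract k).
Proof.
case: k => -[r|] c; rewrite /retract /valid /positive /block /=.
all: by case oc: (odd c) => /=; lia. Qed.

Lemma retract_standard b j : retract (standard b j) = standard b j.
Proof. by rewrite /retract /block /positive /= doubleK odd_double; case: b. Qed.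

(* Stage [J] of the collapse: in the blocks before [J] every domino has been
   moved to its retract, in block [J] dominoes and their retracts coexist. *)
Definition collapse (J : nat) (d : pred nat) : pred nat :=
  fun i => d i && ((i < J.*2)%N ==> ~~ odd i).

Lemma collapse_admissible n J d : admissible n d -> admissible n (collapse J d).
Proof.
move=> ad i /andP[/ad[? ndi] _]; split=> //.
by rewrite /collapse negb_and ndi.
Qed.

(** Only starts before column [J.*2] are discarded, so horizontal dominoes of later blocks stay, and
    a smaller column set never excludes a vertical domino. *)
Lemma tile_collapse J d k : tile d k -> (J <= block k)%N ->
  tile (collapse J d) k.
Proof.
rewrite /tile /block /collapse; case: k => -[r|] c /= tk Jc.
  by rewrite tk /=; apply/implyP; lia.
move/andP: tk => [/negbTE -> /orP[->//|/negbTE->]]; by rewrite orbT.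
Qed.

(** A vertical domino in either column of the block rules out a horizontal pair starting at the even
    column, and so does a pair starting at the odd column. Hence all dominoes of one block in a face
    share their sign. *)
Lemma tile_positive n d k : admissible n d -> tile d k ->
  positive k = ~~ d (block k).*2.
Proof.
move=> ad; case: k => -[r|] c; rewrite /tile /positive /block /= => tk.
  have [oc|ec] := boolP (odd c).
    apply/esym/negP => /ad[_ /negP]; apply.
    by have -> : ((c./2).*2.+1 = c)%N by lia.
  by have -> : (c./2.*2 = c)%N; [lia | rewrite tk].
move: tk => /andP[dc h]; apply/esym; have [oc|ec] := boolP (odd c).
  case/orP: h => [/eqP c0|]; first by rewrite c0 in oc.
  by have -> : (c.-1 = c./2.*2)%N by lia.
by have -> : (c./2.*2 = c)%N by lia.
Qed.

(** A vertical retract in block [j] could only be excluded by a start at [j.*2], impossible by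
    [tile_positive], or at [j.*2.-1], which is odd and before [J.*2], hence discarded. *)
Lemma tile_collapse_retract n J d k : admissible n d -> tile d k -> (block k <= J)%N ->
  tile (collapse J d) (retract k).
Proof.
move=> ad tk kJ; rewrite /retract (tile_positive ad tk) /tile /collapse /=.
rewrite odd_double implybT andbT.
case: (d _) => //=; case: (eqVneq (block k) 0)%N => [->//|nz] /=.
by rewrite negb_and; apply/orP; right; lia.
Qed.

(** No horizontal pair starts in the last column, and a start just before it is odd and already
    discarded. So this edge can be added to every collapsed face and serves as a cone apex. *)
Lemma tile_last n m J d : n = m.*2.+1 -> (m <= J)%N -> admissible n d ->
  tile (collapse J d) (None, m.*2).
Proof.
move=> -> mJ ad; rewrite /tile /collapse /=.
have /negbTE -> : ~~ d m.*2 by apply/negP => /ad[]; lia.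
case: (eqVneq m 0)%N => [->//|nz] /=.
by rewrite negb_and; apply/orP; right; apply/orP; right; lia.
Qed.

(** * Continuity, and pushing mass along a kernel *)

Lemma ptws_continuous_at (S T : topologicalType) (I : eqType)
    (f : S -> {ptws I -> T}) x :
  (forall i, {for x, continuous (fun s => f s i)}) -> {for x, continuous f}.
Proof.
move=> cf; apply/cvg_sup => i A.
rewrite [X in X A -> _](@nbhsE (initial_topology (fun g : I -> T => g i))).
move=> -[_ [[B oB <-] Bfx] BA].
by apply: filterS BA _; apply: (cf i B); exact: open_nbhs_nbhs.
Qed.

Lemma ptws_eval_continuous (T : topologicalType) (I : eqType) (i : I) :
  continuous (fun f : {ptws I -> T} => f i).
Proof. exact: (@proj_continuous I (fun=> T) i). Qed.

Lemma mx_continuous_at (S T : topologicalType) m n (f : S -> 'M[T]_(m, n)) x :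
  (forall i j, {for x, continuous (fun s => f s i j)}) -> {for x, continuous f}.
Proof.
move=> cf A [P nP PA].
have : \forall y \near x, forall i j, P i j (f y i j).
  apply: filter_forall => i; apply: filter_forall => j.
  exact: (cf i j (P i j) (nP i j)).
by apply: filterS => y Py; exact: PA.
Qed.

Lemma continuous_sum (R : realType) (S : topologicalType) (I : Type) (r : seq I)
    (P : pred I) (F : I -> S -> R) :
  (forall i, continuous (F i)) -> continuous (fun s => \sum_(i <- r | P i) F i s).
Proof. by move=> cF; apply: continuous_big => //; exact: add_continuous. Qed.

Lemma continuous_mul (R : realType) (S : topologicalType) (f g : S -> R) :
  continuous f -> continuous g -> continuous (fun s => f s * g s).
Proof. by move=> cf cg x; apply: continuousM; [exact: cf|exact: cg]. Qed.

Lemma continuous_add (R : realType) (S : topologicalType) (f g : S -> R) :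
  continuous f -> continuous g -> continuous (fun s => f s + g s).
Proof. by move=> cf cg x; apply: (@continuousD R R^o); [exact: cf|exact: cg]. Qed.

Lemma continuous_sub (R : realType) (S : topologicalType) (f g : S -> R) :
  continuous f -> continuous g -> continuous (fun s => f s - g s).
Proof. by move=> cf cg x; apply: (@continuousB R R^o); [exact: cf|exact: cg]. Qed.

(** Clamped times make the homotopies continuous on the whole ambient space, so continuity within
    the subspace comes by restriction. *)
Definition clamp (R : realType) (t : R) : R := Num.max 0 (Num.min 1 t).

Lemma clamp_continuous (R : realType) : continuous (@clamp R).
Proof.
move=> t; apply: (@continuous_max R _ (cst 0)); first exact: cst_continuous.
by apply: (@continuous_min R _ (cst 1) id); [exact: cst_continuous|].
Qed.

Lemma clamp_itv (R : realType) (t : R) : 0 <= clamp t <= 1.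
Proof. by rewrite /clamp le_max lexx ge_max ler01 ge_min lexx. Qed.

Lemma clamp0 (R : realType) (t : R) : t <= 0 -> clamp t = 0.
Proof. by move=> t0; rewrite /clamp max_l // ge_min t0 orbT. Qed.

Lemma clamp1 (R : realType) (t : R) : 1 <= t -> clamp t = 1.
Proof. by move=> t1; rewrite /clamp min_l // max_r. Qed.

Section Pushforward.
Variables (R : realType) (n : nat).
Local Notation E := (grid_edge n).
Local Notation X := (pm_complex_realization R n).

(** In barycentric coordinates, the linear extension of the map sending the vertex [e] to the point
    [K e]. *)
Definition push (K : E -> E -> R) (x : {ptws E -> R}) : {ptws E -> R} :=
  fun e' => \sum_e x e * K e e'.

Lemma push_continuous (K : R -> E -> E -> R) :
  (forall e e', continuous (fun t => K t e e')) ->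
  continuous (fun z : R * {ptws E -> R} => push (K z.1) z.2).
Proof.
move=> cK; move=> z; apply: ptws_continuous_at => e'; move: z; apply: continuous_sum => e.
apply: continuous_mul => z.
  apply: (@continuous_comp _ _ _ snd (fun x : {ptws E -> R} => x e)).
    exact: cvg_snd.
  exact: ptws_eval_continuous.
by apply: (continuous_comp _ (cK e e' _)); exact: cvg_fst.
Qed.

(** A stochastic kernel preserves total mass, and the support of the image lies in the union of the
    supports of [K e] for [e] in the support of [x]. It suffices that one face contains this
    union. *)
Lemma realization_push (K : E -> E -> R) d (x : {ptws E -> R}) :
  (forall e e', 0 <= K e e') -> (forall e, \sum_(e' : E) K e e' = 1) ->
  admissible n d ->
  (forall e e', x e != 0 -> K e e' != 0 -> tile d (edge_code e')) ->
  X x -> X (push K x).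
Proof.
move=> K0 K1 ad sd [x0 [x1 _]]; split; last split.
- by move=> e'; apply: sumr_ge0 => e _; exact: mulr_ge0.
- rewrite exchange_big -[RHS]x1 /=; apply: eq_bigr => e _.
  by rewrite -mulr_sumr K1 mulr1.
- apply/pm_faceP; exists d => // e'; rewrite inE => /eqP nz.
  have [//|ntile] := boolP (tile d (edge_code e')); case: nz; apply: big1 => e _.
  have [->|xe] := eqVneq (x e) 0; first by rewrite mul0r.
  have [->|Ke] := eqVneq (K e e') 0; first by rewrite mulr0.
  by rewrite (sd _ _ xe Ke) in ntile.
Qed.

End Pushforward.

(** The default [e] of [insubd] is never returned, because the retract of a valid code is valid. *)
Definition edge_retract (n : nat) (e : grid_edge n) : grid_edge n :=
  insubd e (domino n (retract (edge_code e))).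

Lemma code_edge_retract n (e : grid_edge n) : edge_code (edge_retract e) = retract (edge_code e).
Proof.
have vr := retract_valid (code_valid e).
by apply: codeE => //; rewrite /edge_retract insubdK //; exact: domino_is_edge.
Qed.

Lemma block_lt n (e : grid_edge n) : (block (edge_code e) < n)%N.
Proof. by have := code_valid e; case: (edge_code e) => -[r|] c; rewrite /valid /block /=; lia. Qed.

(** * Sliding the mass block by block onto the standard edges *)

Section Slide.
Variables (R : realType) (n : nat).
Local Notation E := (grid_edge n).
Local Notation X := (pm_complex_realization R n).

(* The mass of the edges in block [J] moves to their retracts at times
   [J <= tau <= J + 1]. *)
Definition progress (tau : R) (e : E) : R := clamp (tau - (block (edge_code e))%:R).

Definition slide (tau : R) (e e' : E) : R :=
  (1 - progress tau e) * (e' == e)%:R + progress tau e * (e' == edge_retract e)%:R.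

Lemma sum_indicator (I : finType) (i0 : I) : \sum_i (i == i0)%:R = 1 :> R.
Proof. by rewrite (bigD1 i0) //= eqxx big1 ?addr0 // => i /negbTE ->. Qed.

Lemma progress_continuous e : continuous (progress ^~ e).
Proof.
have : continuous (fun t : R => t - (block (edge_code e))%:R).
  by apply: continuous_sub => ?; [exact: cvg_id|exact: cvg_cst].
by move=> cb t; apply: (continuous_comp (cb t)); exact: clamp_continuous.
Qed.

Lemma slide_continuous e e' : continuous (fun tau => slide tau e e').
Proof.
apply: continuous_add; apply: continuous_mul.
- by apply: continuous_sub; [move=> ?; exact: cvg_cst|exact: progress_continuous].
- by move=> ?; exact: cvg_cst.
- exact: progress_continuous.
- by move=> ?; exact: cvg_cst.
Qed.

Lemma slide_ge0 tau e e' : 0 <= slide tau e e'.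
Proof.
have /andP[p0 p1] := clamp_itv (tau - (block (edge_code e))%:R).
by apply: addr_ge0; apply: mulr_ge0 => //; rewrite subr_ge0.
Qed.

Lemma slide_sum tau e : \sum_e' slide tau e e' = 1.
Proof. by rewrite big_split /= -!mulr_sumr !sum_indicator; ring. Qed.

(** With [J] the integer part of [tau], blocks before [J] have finished moving, blocks after [J]
    have not started, and only in block [J] do [e] and its retract both carry mass. Stage [J] of the
    collapse allows exactly this. *)
Lemma slide_tile tau d e e' : 0 <= tau -> admissible n d -> tile d (edge_code e) ->
  slide tau e e' != 0 -> tile (collapse (Num.truncn tau) d) (edge_code e').
Proof.
move=> t0 ad te; have /andP[Jt tJ] := truncn_itv t0; rewrite /slide /progress.
have [->|_] := eqVneq e' e.
  have [bJ|Jb _] := ltnP (block (edge_code e)) (Num.truncn tau); last first.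
    exact: tile_collapse te Jb.
  rewrite clamp1 ?subrr ?mul0r ?add0r ?mul1r; last first.
    by rewrite lerBrDr nat1r; apply: le_trans Jt; rewrite ler_nat.
  (* Once its block has finished, [e] keeps mass only if it is its own retract. *)
  have [eqe|] := eqVneq e (edge_retract e); last by rewrite eqxx.
  by move=> _; rewrite eqe code_edge_retract; apply: (tile_collapse_retract ad te); exact: ltnW.
rewrite mulr0 add0r; have [->|_] := eqVneq e' (edge_retract e); last by rewrite mulr0 eqxx.
rewrite mulr1 code_edge_retract => nz; apply: (tile_collapse_retract ad te).
rewrite leqNgt; apply/negP => Jb; move/negP: nz; apply; rewrite clamp0 //.
by rewrite subr_le0; apply: le_trans (ltW tJ) _; rewrite ler_nat.
Qed.

Lemma realization_slide tau (x : {ptws E -> R}) : 0 <= tau -> X x -> X (push (slide tau) x).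
Proof.
move=> t0 Xx; have [_ [_ /pm_faceP[d ad sd]]] := Xx.
apply: (realization_push (d := collapse (Num.truncn tau) d)) => //.
- exact: slide_ge0.
- exact: slide_sum.
- exact: collapse_admissible.
- by move=> e e' xe; apply: slide_tile => //; apply: sd; rewrite inE.
Qed.

Lemma slide0 e e' : slide 0 e e' = (e' == e)%:R.
Proof. by rewrite /slide /progress clamp0 ?subr0 ?mul1r ?mul0r ?addr0 // sub0r oppr_le0. Qed.

(** Every block index is less than [n], so by time [n] each block has completed its unit of time. *)
Lemma slide_end tau e e' : n%:R <= tau -> slide tau e e' = (e' == edge_retract e)%:R.
Proof.
move=> nt; rewrite /slide /progress clamp1 ?subrr ?mul0r ?add0r ?mul1r //.
by rewrite lerBrDr nat1r; apply: le_trans nt; rewrite ler_nat block_lt.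
Qed.

Lemma push_id (K : E -> E -> R) (x : {ptws E -> R}) :
  (forall e e', K e e' = (e' == e)%:R) -> push K x = x.
Proof.
move=> KE; apply/funext => e'; rewrite /push (bigD1 e') //= KE eqxx mulr1.
by rewrite big1 ?addr0 // => e /negbTE ne; rewrite KE eq_sym ne mulr0.
Qed.

End Slide.

(** * Odd grids: collapse, then cone to the last vertical edge *)

Section Odd.
Variables (R : realType) (n m : nat).
Hypothesis nE : n = m.*2.+1.
Local Notation E := (grid_edge n).
Local Notation X := (pm_complex_realization R n).

Lemma odd_realization_contractible : contractible R X.
Proof.
have [apex apexE] : exists e : E, edge_code e = (None, m.*2).
  by apply: code_surj; rewrite nE /valid /=.
pose delta : {ptws E -> R} := fun e => (e == apex)%:R.
(* The cone phase occupies the times from [n] to [n + 1], after the slide is complete. *)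
pose psi (tau : R) : R := clamp (tau - n%:R).
(* Time is reversed, from [n + 1] down to [0], because the homotopy must start at the constant map
   and end at the identity. *)
pose tm (t : R) : R := n.+1%:R * (1 - t).
pose K (t : R) (e e' : E) : R :=
  (1 - psi (tm t)) * slide (tm t) e e' + psi (tm t) * (e' == apex)%:R.
have psi_itv tau : 0 <= psi tau <= 1 by exact: clamp_itv.
exists delta.
  split; first by move=> e; rewrite /delta.
  split; first exact: sum_indicator.
  (* The empty column set is the all-vertical tiling, which contains the apex. *)
  apply/pm_faceP; exists pred0 => // e; rewrite inE /delta.
  by have [->|] := eqVneq e apex; rewrite ?eqxx // apexE /tile /= orbT.
exists (fun z => push (K z.1) z.2); split.
- apply: continuous_subspaceT; apply: push_continuous => e e'.
  have ctau : continuous tm.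
    apply: continuous_mul; first by move=> ?; exact: cvg_cst.
    by apply: continuous_sub => ?; [exact: cvg_cst|exact: cvg_id].
  have cpsi : continuous (fun t : R => psi (tm t)).
    have cn : continuous (fun t : R => tm t - n%:R).
      by apply: continuous_sub => // ?; exact: cvg_cst.
    by move=> t; apply: (continuous_comp (cn t)); exact: clamp_continuous.
  apply: continuous_add; apply: continuous_mul.
  + by apply: continuous_sub => //; exact: cst_continuous.
  + move=> t; apply: (@continuous_comp _ _ _ tm (fun tau => slide tau e e')).
      exact: ctau.
    exact: slide_continuous.
  + exact: cpsi.
  + exact: cst_continuous.
- move=> t x /andP[t0 t1] Xx /=.
  have [_ [_ /pm_faceP[d ad sd]]] := Xx.
  set tau := tm t.
  have tau0 : 0 <= tau by apply: mulr_ge0 => //; rewrite subr_ge0.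
  have /andP[psi0 psi1] := psi_itv tau.
  apply: (realization_push (d := collapse (Num.truncn tau) d)) => //.
  + move=> e e'; apply: addr_ge0; apply: mulr_ge0 => //; first by rewrite subr_ge0.
    exact: slide_ge0.
  + by move=> e; rewrite big_split /= -!mulr_sumr slide_sum sum_indicator; ring.
  + exact: collapse_admissible.
  + move=> e e' xe; have te : tile d (edge_code e) by apply: sd; rewrite inE.
    rewrite /K -/tau; have [->|Ke _] := eqVneq (slide tau e e') 0; last first.
      exact: slide_tile Ke.
    rewrite mulr0 add0r; have [->|_] := eqVneq e' apex; last by rewrite mulr0 eqxx.
    rewrite mulr1 apexE => psin; apply: (tile_last nE) => //.
    (* Positive weight on the apex means that the cone phase has begun, so the collapse has passed
       stage [m] as [tile_last] requires. *)
    have nt : n%:R <= tau.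
      rewrite leNgt; apply/negP => tn; move/negP: psin; apply.
      by rewrite /psi clamp0 // subr_le0 ltW.
    rewrite -(ler_nat R); apply: le_trans (_ : n%:R <= _).
      by rewrite ler_nat nE; lia.
    by rewrite ler_nat truncn_ge_nat.
- move=> x [_ [x1 _]]; apply/funext => e'; rewrite /push /K /psi /tm /=.
  rewrite subr0 mulr1 clamp1; last by rewrite -natr1 addrAC subrr add0r.
  under eq_bigr do rewrite subrr mul0r add0r mul1r.
  by rewrite -mulr_suml x1 mul1r.
- move=> x _; apply: push_id => e e'; rewrite /K /psi /tm /= subrr mulr0 slide0.
  by rewrite clamp0 ?sub0r ?oppr_le0 // subr0 mul1r mul0r addr0.
Qed.

End Odd.

(** * Even grids *)

Section Even.
Variables (R : realType) (n k : nat).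
Hypothesis nE : n = (2 * k + 2)%N.
Local Notation E := (grid_edge n).
Local Notation X := (pm_complex_realization R n).
Local Notation rV := 'rV[R]_k.+1.
Local Notation std p := (standard p.1 (nat_of_ord p.2)).

(** Evenness enters here: the blocks [0] to [k] all have both columns, so both standard edges of
    each block exist. *)
Let std_valid (p : bool * 'I_k.+1) : valid n (std p).
Proof. by case: p => -[] [j hj]; rewrite nE /valid /=; lia. Qed.

Let std_inj (p q : bool * 'I_k.+1) : (std p == std q) = (p == q).
Proof.
apply/eqP/eqP => [/standard_inj[]|->//]; case: p q => [b j] [b' j'] /= -> /val_inj -> //.
Qed.

Let retract_std (e : E) : exists p : bool * 'I_k.+1, retract (edge_code e) = std p.
Proof.
have bk : (block (edge_code e) < k.+1)%N.
  have := code_valid e; have := nE; case: (edge_code e) => -[r|] c; rewrite /valid /block /=; lia.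
by exists (positive (edge_code e), Ordinal bk).
Qed.

(* [part (b, j) x] is the mass which the collapse brings to the vertical
   ([b = true]) or the horizontal ([b = false]) standard edge of block [j]. *)
Definition part (p : bool * 'I_k.+1) (x : {ptws E -> R}) : R :=
  \sum_(e | retract (edge_code e) == std p) x e.

(** The retracted point, seen in the boundary of the cross-polytope in dimension [k.+1]; [to_sphere]
    then projects it radially. *)
Definition height (x : {ptws E -> R}) : rV :=
  \row_j (part (true, j) x - part (false, j) x).

Definition norm2 (y : rV) : R := Num.sqrt (\sum_j y ord0 j ^+ 2).

Definition norm1 (y : rV) : R := \sum_j `|y ord0 j|.

Definition to_sphere (x : {ptws E -> R}) : rV := (norm2 (height x))^-1 *: height x.

Definition signed_part (y : rV) (p : bool * 'I_k.+1) : R :=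
  Num.max 0 (if p.1 then y ord0 p.2 else - y ord0 p.2).

(** Radial projection to the unit sphere of [norm1], whose points are then read as barycentric
    coordinates on the standard edges. *)
Definition from_sphere (y : rV) : {ptws E -> R} :=
  fun e => (\sum_p signed_part y p * (edge_code e == std p)%:R) / norm1 y.

Lemma sum_bool_ord (F : bool * 'I_k.+1 -> R) :
  \sum_p F p = \sum_j (F (true, j) + F (false, j)).
Proof.
transitivity (\sum_p F (p.1, p.2)); first by apply: eq_bigr => -[].
rewrite -(pair_bigA _ (fun b j => F (b, j))) /= big_split /=.
by rewrite big_bool.
Qed.

Lemma signed_part_ge0 y p : 0 <= signed_part y p.
Proof. by rewrite /signed_part le_max lexx. Qed.

Lemma signed_partB y j :
  signed_part y (true, j) - signed_part y (false, j) = y ord0 j.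
Proof.
rewrite /signed_part /=; have [h|h] := leP 0 (y ord0 j).
  by rewrite max_l ?subr0 // oppr_le0.
by rewrite max_r ?sub0r ?opprK // oppr_ge0 ltW.
Qed.

Lemma signed_partD y : \sum_p signed_part y p = norm1 y.
Proof.
rewrite sum_bool_ord; apply: eq_bigr => j _; rewrite /signed_part /=.
have [h|h] := leP 0 (y ord0 j); first by rewrite max_l ?addr0 ?ger0_norm // oppr_le0.
by rewrite max_r ?add0r ?ltr0_norm // oppr_ge0 ltW.
Qed.

Lemma signed_partZ (a : R) y p : 0 <= a -> signed_part (a *: y) p = a * signed_part y p.
Proof.
move=> a0; rewrite /signed_part maxr_pMr // mulr0 mxE.
by case: p.1; rewrite ?mulrN.
Qed.

Lemma norm1Z (a : R) y : 0 <= a -> norm1 (a *: y) = a * norm1 y.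
Proof.
move=> a0; rewrite -!signed_partD mulr_sumr; apply: eq_bigr => p _.
exact: signed_partZ.
Qed.

Lemma sum_code (P : pred domino_code) (p : bool * 'I_k.+1) :
  \sum_(e : E | P (edge_code e)) (edge_code e == std p)%:R = (P (std p))%:R :> R.
Proof.
have [e0 e0E] := code_surj (std_valid p).
have [Pp|nPp] := boolP (P (std p)).
  rewrite (bigD1 e0) ?e0E //= eqxx big1 ?addr0 // => e /andP[_ ne].
  by rewrite -e0E (inj_eq (@code_inj n)) (negbTE ne).
rewrite big1 // => e Pe; case: eqP => // ee.
by rewrite ee (negbTE nPp) in Pe.
Qed.

(** A general [P] serves both for the mass in one [part] and for the total mass. *)
Lemma sum_from_sphere (P : pred domino_code) y :
  \sum_(e : E | P (edge_code e)) from_sphere y e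
    = (\sum_p signed_part y p * (P (std p))%:R) / norm1 y.
Proof.
rewrite -mulr_suml exchange_big; congr (_ / _); apply: eq_bigr => p _.
by rewrite -mulr_sumr sum_code.
Qed.

Lemma part_from_sphere p y : part p (from_sphere y) = signed_part y p / norm1 y.
Proof.
rewrite /part (sum_from_sphere (fun c => retract c == std p)); congr (_ / _).
rewrite (bigD1 p) //= retract_standard eqxx mulr1 big1 ?addr0 // => q qp.
by rewrite retract_standard std_inj (negbTE qp) mulr0.
Qed.

Lemma height_from_sphere y : height (from_sphere y) = (norm1 y)^-1 *: y.
Proof.
apply/rowP => j; rewrite !mxE !part_from_sphere -mulrBl signed_partB.
by rewrite mulrC.
Qed.

Lemma norm1_ge0 y : 0 <= norm1 y.
Proof. by apply: sumr_ge0. Qed.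

Lemma norm1_eq0 y : norm1 y = 0 -> y = 0.
Proof.
move=> /eqP; rewrite psumr_eq0 // => /allP y0; apply/rowP => j; rewrite mxE.
by have := y0 j (mem_index_enum _); rewrite /= normr_eq0 => /eqP.
Qed.

Lemma sqr_norm2 y : norm2 y ^+ 2 = \sum_j y ord0 j ^+ 2.
Proof. by rewrite sqr_sqrtr // sumr_ge0 // => j _; exact: sqr_ge0. Qed.

Lemma norm2_eq0 y : norm2 y = 0 -> y = 0.
Proof.
move=> y0; have /eqP := sqr_norm2 y; rewrite y0 expr0n /= eq_sym psumr_eq0; last first.
  by move=> j _; exact: sqr_ge0.
move=> /allP {}y0; apply/rowP => j; rewrite mxE.
by have := y0 j (mem_index_enum _); rewrite /= sqrf_eq0 => /eqP.
Qed.

Lemma norm2Z (a : R) y : 0 <= a -> norm2 (a *: y) = a * norm2 y.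
Proof.
move=> a0; rewrite /norm2 -[in RHS](ger0_norm a0) -sqrtr_sqr -sqrtrM ?sqr_ge0 // mulr_sumr.
by congr Num.sqrt; apply: eq_bigr => j _; rewrite mxE exprMn.
Qed.

Lemma sphere_norm2 y : sphere R k y -> norm2 y = 1.
Proof. by rewrite /sphere /norm2 /= => ->; rewrite sqrtr1. Qed.

Lemma sphere_norm1 y : sphere R k y -> norm1 y != 0.
Proof.
move=> yS; apply/eqP => /norm1_eq0 y0; have := sphere_norm2 yS.
have -> : norm2 y = 0.
  rewrite /norm2 y0 big1 ?sqrtr0 // => j _; by rewrite mxE expr0n.
by move/eqP; rewrite eq_sym oner_eq0.
Qed.

(** The two radial projections cancel, so this composite is the identity on the sphere and the
    constant homotopy suffices. *)
Lemma to_from_sphere y : sphere R k y -> to_sphere (from_sphere y) = y.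
Proof.
move=> yS; have y1 := sphere_norm1 yS; rewrite /to_sphere height_from_sphere.
rewrite norm2Z ?invr_ge0 ?norm1_ge0 // (sphere_norm2 yS) mulr1 invrK scalerA.
by rewrite divff // scale1r.
Qed.

Lemma from_sphere_realization y : sphere R k y -> X (from_sphere y).
Proof.
move=> yS; have y1 := sphere_norm1 yS; split; last split.
- move=> e; apply: divr_ge0; last exact: norm1_ge0.
  by apply: sumr_ge0 => p _; apply: mulr_ge0 => //; exact: signed_part_ge0.
- rewrite (sum_from_sphere xpredT) -signed_partD.
  under eq_bigr do rewrite mulr1.
  by rewrite signed_partD divff.
apply/pm_faceP.
(* Horizontal pairs fill the blocks with a negative coordinate; all starts are even, hence never
   adjacent. *)
exists (fun i => [exists j : 'I_k.+1, (i == j.*2) && (y ord0 j < 0)]).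
  move=> i /existsP[j /andP[/eqP -> _]]; have := ltn_ord j; split; first by lia.
  by apply/existsP => -[j' /andP[/eqP]]; lia.
move=> e; rewrite inE => nz.
have [p pnz pE] : exists2 p, signed_part y p != 0 & edge_code e = std p.
  have [//|none] := pselect (exists2 p, signed_part y p != 0 & edge_code e = std p).
  case/negP: nz; rewrite /from_sphere big1 ?mul0r // => p _.
  have [->|sp] := eqVneq (signed_part y p) 0; first by rewrite mul0r.
  by case: eqP => [ep|_]; rewrite ?mulr0 //; case: none; exists p.
rewrite pE; case: p pnz {pE} => -[] j; rewrite /signed_part /tile /= => pnz.
  apply/andP; split.
    apply/existsP => -[j' /andP[/eqP jj' yj']]; case/negP: pnz.
    have -> : j = j' by apply: val_inj => /=; lia.
    by rewrite max_l // ltW.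
  case: (eqVneq j.*2 0)%N => //= j0.
  by apply/existsP => -[j' /andP[/eqP]]; lia.
apply/existsP; exists j; rewrite eqxx /=; rewrite ltNge; apply/negP => yj.
by case/negP: pnz; rewrite max_l // oppr_le0.
Qed.

Section OnComplex.
Variable x : {ptws E -> R}.
Hypothesis Xx : X x.

Let part_ge0 p : 0 <= part p x.
Proof. by case: Xx => x0 _; apply: sumr_ge0 => e _; exact: x0. Qed.

(* The edges collapsing to the two standard edges of a block never meet in a
   face, so [height] loses no information about [part]. *)
Let part_exclusive j : part (true, j) x = 0 \/ part (false, j) x = 0.
Proof.
have [_ [_ /pm_faceP[d ad sd]]] := Xx.
have find p : part p x != 0 ->
    exists2 e : E, tile d (edge_code e) & positive (edge_code e) = p.1 /\ block (edge_code e) = p.2.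
  move=> nz; have [//|none] := pselect (exists2 e : E, tile d (edge_code e) &
    positive (edge_code e) = p.1 /\ block (edge_code e) = p.2).
  case/negP: nz; rewrite /part big1 // => e /eqP/standard_inj bp.
  have [//|xe] := eqVneq (x e) 0; case: none; exists e => //.
  by apply: sd; rewrite inE.
have [|/find[e te [pe be]]] := eqVneq (part (true, j) x) 0; first by left.
have [|/find[e' te' [pe' be']]] := eqVneq (part (false, j) x) 0; first by right.
have := tile_positive ad te; have := tile_positive ad te'.
by rewrite pe pe' be be' /= => <-.
Qed.

Let signed_part_height p : signed_part (height x) p = part p x.
Proof.
case: p => b j; have ge0 b' := part_ge0 (b', j); rewrite /signed_part mxE /=.
case: (part_exclusive j) => z; move: (ge0 true) (ge0 false); rewrite z.
  case: b; rewrite sub0r ?opprK => _ ge; first by rewrite z max_l // oppr_le0.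
  exact: max_r.
by case: b; rewrite subr0 => ge _; [exact: max_r|rewrite z max_l // oppr_le0].
Qed.

(** The signed parts of the height are the masses [part p x]. These partition the total mass [1] by
    retract, so the height lies on the boundary of the cross-polytope and is nonzero. *)
Lemma norm1_height : norm1 (height x) = 1.
Proof.
rewrite -signed_partD; under eq_bigr do rewrite signed_part_height /part.
have [_ [<- _]] := Xx.
rewrite (exchange_big_dep xpredT) //=; apply: eq_bigr => e _.
have [p pE] := retract_std e; rewrite (big_pred1 p) // => q.
by rewrite pE std_inj eq_sym.
Qed.

Lemma norm2_height : norm2 (height x) != 0.
Proof.
apply/eqP => /norm2_eq0 h0; have := norm1_height; rewrite h0 /norm1 big1.
  by move/eqP; rewrite eq_sym oner_eq0.
by move=> j _; rewrite mxE normr0.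
Qed.

Lemma to_sphereP : sphere R k (to_sphere x).
Proof.
rewrite /sphere /to_sphere /=; under eq_bigr do rewrite mxE exprMn.
by rewrite -mulr_sumr -sqr_norm2 -exprMn mulVf ?norm2_height // expr1n.
Qed.

(** Since [norm1] of the height is [1], the scaling by [norm2] cancels and the round trip just moves
    each edge's mass to its retract, as the slide has done by time [n]. *)
Lemma from_to_sphere : from_sphere (to_sphere x) = push (slide n%:R) x.
Proof.
have a0 : 0 <= (norm2 (height x))^-1 by rewrite invr_ge0 sqrtr_ge0.
apply/funext => e; rewrite /from_sphere norm1Z // norm1_height mulr1.
under eq_bigr do rewrite signed_partZ // -mulrA.
rewrite -mulr_sumr mulrAC divff ?mul1r; last by rewrite invr_eq0 norm2_height.
under eq_bigr do rewrite signed_part_height /part big_distrl /=.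
rewrite (exchange_big_dep xpredT) //=; apply: eq_bigr => e' _.
rewrite slide_end //.
have [p pE] := retract_std e'; rewrite (big_pred1 p); last first.
  by move=> q; rewrite pE std_inj eq_sym.
by rewrite -(inj_eq (@code_inj n)) code_edge_retract pE.
Qed.

End OnComplex.

Lemma to_sphere_continuous : {within X, continuous to_sphere}.
Proof.
have cpart p : continuous (part p : {ptws E -> R} -> R).
  by apply: continuous_sum => e; exact: ptws_eval_continuous.
have ch j : continuous (fun x => height x ord0 j).
  rewrite (_ : (fun x => _) = fun x => part (true, j) x - part (false, j) x).
    by apply: continuous_sub; exact: cpart.
  by apply/funext => x; rewrite mxE.
have cn : continuous (fun x => norm2 (height x)).
  have cs : continuous (fun x => \sum_j height x ord0 j ^+ 2).
    by apply: continuous_sum => j; apply: continuous_mul; exact: ch.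
  by move=> x; apply: (continuous_comp (cs x)); exact: sqrt_continuous.
(* Continuity is checked at points of the complex only, where the denominator is nonzero. *)
apply: continuous_in_subspaceT => x /set_mem Xx; apply: mx_continuous_at => i j.
rewrite (_ : (fun s => _) = fun s => (norm2 (height s))^-1 * height s ord0 j); last first.
  by apply/funext => s; rewrite mxE ord1.
apply: continuousM; last exact: ch.
by apply: continuousV; [exact: norm2_height|exact: cn].
Qed.

Lemma from_sphere_continuous : {within sphere R k, continuous from_sphere}.
Proof.
have cs p : continuous (fun y : rV => signed_part y p).
  move=> y; apply: (@continuous_max R _ (cst 0)); first exact: cst_continuous.
  case: p.1; last apply: (@continuousN R R^o); exact: coord_continuous.
have c1 : continuous norm1.
  apply: continuous_sum => j y.
  apply: (@continuous_comp _ _ _ (fun y : rV => y ord0 j)).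
    exact: coord_continuous.
  exact: norm_continuous.
apply: continuous_in_subspaceT => y /set_mem yS; apply: ptws_continuous_at => e.
apply: continuousM; last by apply: continuousV; [exact: sphere_norm1|exact: c1].
move: y yS => y _; move: y; apply: continuous_sum => p; apply: continuous_mul => //.
exact: cst_continuous.
Qed.

Lemma even_realization_sphere : homotopy_equivalent R X (sphere R k).
Proof.
exists to_sphere, from_sphere; split.
- by split; [exact: to_sphere_continuous|exact: from_sphere_continuous].
- by move=> x; exact: to_sphereP.
- exact: from_sphere_realization.
(* The slide is run backwards: time [n] gives the round trip by [from_to_sphere], time [0] the
   identity. *)
- exists (fun z => push (slide (n%:R * (1 - z.1))) z.2); split.
  + apply: continuous_subspaceT.
    apply: (push_continuous (K := fun t => slide (n%:R * (1 - t)))) => e e'.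
    have ct : continuous (fun t : R => n%:R * (1 - t)).
      apply: continuous_mul; first exact: cst_continuous.
      by apply: continuous_sub => ?; [exact: cvg_cst|exact: cvg_id].
    move=> t; apply: (@continuous_comp _ _ _ (fun t : R => n%:R * (1 - t))
      (fun tau => slide tau e e')).
      exact: ct.
    exact: slide_continuous.
  + move=> t x /andP[t0 t1] Xx; apply: realization_slide => //=.
    by apply: mulr_ge0 => //; rewrite subr_ge0.
  + by move=> x Xx; rewrite /= subr0 mulr1 from_to_sphere.
  + by move=> x _; apply: push_id => e e'; rewrite /= subrr mulr0 slide0.
- exists snd; split=> //.
  + by apply: continuous_subspaceT => ?; exact: cvg_snd.
  + by move=> y yS; rewrite /= to_from_sphere.
Qed.

End Even.

Theorem theorem3p1 (R : realType) (n : nat) (hn : (1 <= n)%N) :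
  (odd n -> contractible R (pm_complex_realization R n)) /\
  (forall k : nat, n = (2 * k + 2)%N ->
     homotopy_equivalent R (pm_complex_realization R n) (sphere R k)).
Proof.
split=> [on|k nE]; last exact: even_realization_sphere.
by apply: (@odd_realization_contractible _ _ n./2); lia.
Qed.
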